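(* Let $n\ge 1$, let $g\in C(\mathbb{R}^n)\cap L^\infty(\mathbb{R}^n)$ be nonnegative and not identically zero, and let $$u(x,t)=\frac{1}{(4\pi t)^{n/2}}\int_{\mathbb{R}^n} g(y)\,e^{-\frac{|x-y|^2}{4t}}\,dy,\qquad x\in\mathbb{R}^n,\ t>0.$$ Let $\alpha,\beta,\gamma$ be nonnegative constants with $(n-1)(\alpha+\beta)+\gamma\le 1$. Then for all $x\in\mathbb{R}^n$ and $t>0$, $$\frac{\Delta u}{u}-\alpha\sum_{\substack{i,j=1\\ i\neq j}}^{n}\frac{u_{x_ix_j}}{u}-\beta\sum_{\substack{i,j=1\\ i\neq j}}^{n}\frac{u_{x_i}u_{x_j}}{u^2}-\gamma\frac{|\nabla u|^2}{u^2}\ \ge\ -\frac{n}{2t},$$ where all functions are evaluated at $(x,t)$.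
   Context: $u$ is the solution of the heat equation $u_t=\Delta u$ on $\mathbb{R}^n\times(0,\infty)$ given by the heat-kernel representation formula with initial datum $g$; it is smooth and strictly positive for $t>0$. Subscripts denote partial derivatives in the spatial variables, $\Delta u=\sum_{i=1}^n u_{x_ix_i}$ and $|\nabla u|^2=\sum_{i=1}^n u_{x_i}^2$. Sums over $i\ne j$ run over all ordered pairs $(i,j)$ with $i,j\in\{1,\dots,n\}$, $i\neq j$ (empty when $n=1$). *)

(* Defs.v *)
From HB Require Import structures.
From mathcomp Require Import all_boot all_order all_algebra.
From mathcomp Require Import all_classical all_reals all_analysis.
Set Implicit Arguments. Unset Strict Implicit. Unset Printing Implicit Defensive.
Import Order.TTheory GRing.Theory Num.Theory.
Import numFieldNormedType.Exports.
Local Open Scope classical_set_scope.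
Local Open Scope ring_scope.

Section HeatDefs.
Variable R : realType.

(* Squared Euclidean norm |x - y|^2 (the library norm on 'rV is the sup norm,
   so we write the Euclidean one explicitly). *)
Definition sqdist (n : nat) (x y : 'rV[R]_n) : R :=
  \sum_(i < n) (x ord0 i - y ord0 i) ^+ 2.

Definition row_of_seq (n : nat) (s : seq R) : 'rV[R]_n :=
  \row_(i < n) nth 0 s i.

(* Iterated Lebesgue integral over R^k of F : seq R -> \bar R,
   i.e. \int dy_1 \int dy_2 ... \int dy_k F [:: y_1; ...; y_k].
   For nonnegative measurable integrands this equals the Lebesgue integral
   over R^k by Tonelli. *)
Fixpoint iter_integral (k : nat) (F : seq R -> \bar R) : \bar R :=
  match k with
  | 0 => F [::]
  | k'.+1 => (\int[@lebesgue_measure R]_y iter_integral k' (fun s => F (y :: s)))%E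
  end.

Definition integral_Rn (n : nat) (f : 'rV[R]_n -> R) : \bar R :=
  iter_integral n (fun s => (f (row_of_seq n s))%:E).

Definition heat_sol (n : nat) (g : 'rV[R]_n -> R) (x : 'rV[R]_n) (t : R) : R :=
  ((4 * pi * t) `^ (n%:R / 2))^-1 *
  fine (integral_Rn (fun y => g y * expR (- (sqdist x y / (4 * t))))).

Definition unitv (n : nat) (i : 'I_n) : 'rV[R]_n := delta_mx ord0 i.

Definition pd1 (n : nat) (u : 'rV[R]_n -> R -> R) (i : 'I_n) (x : 'rV[R]_n) (t : R) : R :=
  'D_(unitv i) (fun z => u z t) x.

Definition pd2 (n : nat) (u : 'rV[R]_n -> R -> R) (i j : 'I_n) (x : 'rV[R]_n) (t : R) : R :=
  'D_(unitv j) (fun y => 'D_(unitv i) (fun z => u z t) y) x.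

End HeatDefs.

(* Main.v *)
(** In the variable [dx = x - y], the derivatives of the heat kernel give, with
    [s i j] and [m i] the second and first moments of [dx] under the probability
    density proportional to [g y * exp (- |x-y|^2 / 4t)],
      [u_ij / u = - [i = j] / 2t + s i j / 4t^2] and [u_i / u = - m i / 2t].
    So the claim is [0 <= tr s - alpha * (off-diagonal sum of s)
    - beta * (off-diagonal sum of m m^T) - gamma * |m|^2], which follows from
    [2 s_ij <= s_ii + s_jj], [2 m_i m_j <= m_i^2 + m_j^2] and [m_i^2 <= s_ii].

    Differentiating under the iterated integral needs no dominated convergence:
    the first-order Taylor remainder of the integrand is at most [h^2 * D y] with
    [D] integrable, and the integral is linear and monotone. *)
Require Import Defs.
From HB Require Import structures.
From mathcomp Require Import all_boot all_order all_algebra.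
From mathcomp Require Import all_classical all_reals all_analysis.
From mathcomp Require Import measurable_realfun ring lra.
Import Order.TTheory GRing.Theory Num.Theory.
Import numFieldNormedType.Exports.
Local Open Scope classical_set_scope.
Local Open Scope ring_scope.
Set Implicit Arguments. Unset Strict Implicit. Unset Printing Implicit Defensive.

(** * Iterated real integrals and their measurability in a parameter *)

Fixpoint iter_Rintegral {R : realType} (k : nat) (F : seq R -> R) : R :=
  match k with
  | 0 => F [::]
  | k'.+1 => \int[@lebesgue_measure R]_y iter_Rintegral k' (fun s => F (y :: s))
  end.

(* Joint measurability of [k] variables and a parameter, tested on all measurable
   families of arguments: this avoids putting a sigma-algebra on [seq R] or on
   ['rV[R]_n]. *)
Definition seq_measurable {R : realType} (k : nat) {d} {S : measurableType d}
    (F : S -> seq R -> R) : Prop :=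
  forall d' (T : measurableType d') (p : T -> S) (a : nat -> T -> R),
    measurable_fun setT p -> (forall i, measurable_fun setT (a i)) ->
    measurable_fun setT (fun x => F (p x) (mkseq (a^~ x) k)).

(** Turns the outermost integration variable into part of the parameter, as the induction on [k]
    requires: the test family is shifted by one slot, and slot 0 receives the new parameter
    component. *)
Lemma seq_measurable_cons {R : realType} (k : nat) {d} {S : measurableType d}
    (F : S -> seq R -> R) :
  seq_measurable k.+1 F ->
  seq_measurable k (fun (q : S * R) s => F q.1 (q.2 :: s)).
Proof.
move=> mF d' T p a mp ma.
rewrite (_ : (fun x => _) = (fun x => F (p x).1
  (mkseq ((fun i => if i is i'.+1 then a i' else snd \o p)^~ x) k.+1))); last first.
  by apply/funext => x; rewrite /mkseq /= -[1%N]addn0 iotaDl -map_comp.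
apply: mF => [|[|i]]; [exact: (measurableT_comp measurable_fst)| |exact: ma].
exact: (measurableT_comp measurable_snd).
Qed.

(** Tonelli applies to the positive and negative parts separately; their difference is measurable,
    and so is its image under [fine]. *)
Lemma measurable_fun_parametric_Rintegral {R : realType} {d} {S : measurableType d}
    (G : S * R -> R) :
  measurable_fun setT G ->
  measurable_fun setT (fun x => \int[@lebesgue_measure R]_y G (x, y)).
Proof.
move=> mG; rewrite /Rintegral.
have mf : measurable_fun setT (fine : \bar R -> R) by [].
apply: (measurableT_comp mf).
under eq_fun do rewrite integralE.
have mE : measurable_fun setT (EFin \o G) by exact/measurable_EFinP.
have H (f : S * R -> \bar R) : measurable_fun setT f -> (forall q, (0 <= f q)%E) ->
    measurable_fun setT (fun x => (\int[@lebesgue_measure R]_y f (x, y))%E).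
  move=> mf' f0.
  exact: (@measurable_fun_fubini_tonelli_F _ _ S (measurableTypeR R) R
    lebesgue_measure f mf' f0).
apply: emeasurable_funB.
- have := H _ (measurable_funepos mE) (fun q => funepos_ge0 _ q).
  by rewrite unlock.
- have := H _ (measurable_funeneg mE) (fun q => funeneg_ge0 _ q).
  by rewrite unlock.
Qed.

Lemma measurable_iter_Rintegral {R : realType} (k : nat) {d}
    {S : measurableType d} (F : S -> seq R -> R) :
  seq_measurable k F -> measurable_fun setT (fun x => iter_Rintegral k (F x)).
Proof.
elim: k d S F => [|k IHk] d S F mF /=.
  exact: (mF _ S id (fun _ _ => 0)).
apply: (measurable_fun_parametric_Rintegral (G := fun q : S * R =>
  iter_Rintegral k (fun s => F q.1 (q.2 :: s)))).
exact/IHk/seq_measurable_cons.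
Qed.

(** * Iterated integrals dominated by a product of weights 1/(1 + y^2) *)

Section oneDsqrV.
Context {R : realType}.
Local Notation mu := (@lebesgue_measure R).
Local Notation w := (fun y : R => (oneDsqr y)^-1).

Lemma integrable_oneDsqrV : mu.-integrable setT (EFin \o w).
Proof.
have mw : measurable_fun setT w.
  by apply: continuous_measurable_fun; exact: continuous_oneDsqrV.
apply/integrableP; split; first exact/measurable_EFinP.
apply/abse_integralP => //=; first exact/measurable_EFinP.
(* The weight is even, so its integral reduces to the known finite one over the half-line. *)
rewrite ge0_symfun_integralT//=.
- rewrite (_ : [set x | _] = `[0, +oo[%classic); last first.
    by apply/seteqP; split => x/=; rewrite in_itv/= andbT.
  by rewrite integral0y_oneDsqr -EFinM ltry.
- exact: continuous_oneDsqrV.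
- by move=> x/=; rewrite /oneDsqr sqrrN.
Qed.

(** A product weight is chosen because freezing the first variable at [y] only changes the constant
    to [C * w y], which is itself integrable in [y]; every slice stays in the same class. *)
Definition seq_dominated (k : nat) (C : R) (F : seq R -> R) : Prop :=
  seq_measurable k (fun _ : unit => F) /\
  forall s, size s = k -> `|F s| <= C * \prod_(y <- s) w y.

Lemma seq_dominated_cons k C F y : seq_dominated k.+1 C F ->
  seq_dominated k (C * w y) (fun s => F (y :: s)).
Proof.
move=> [mF bF]; split=> [|s sk]; last first.
  by have := bF (y :: s); rewrite big_cons mulrA /= sk => ->.
move=> d T p a mp ma.
exact: (seq_measurable_cons mF (p := fun x => (p x, y))
  (measurable_fun_pair mp (measurable_cst y)) ma).
Qed.

Lemma measurable_iter_Rintegral_cons k C F : seq_dominated k.+1 C F ->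
  measurable_fun setT (fun y => iter_Rintegral k (fun s => F (y :: s))).
Proof.
move=> [mF _].
have h := measurable_iter_Rintegral (seq_measurable_cons mF).
exact: (measurableT_comp h (pair1_measurable tt)).
Qed.

Let W : R := \int[mu]_y w y.

(** The bound at level [k] is a hypothesis because bound and integrability feed each other: this
    integrability is what the inductive step of [iter_Rintegral_bound] uses. *)
Lemma integrable_iter_Rintegral_of_bound k C F :
  (forall C F, seq_dominated k C F -> `|iter_Rintegral k F| <= C * W ^+ k) ->
  seq_dominated k.+1 C F ->
  mu.-integrable setT (EFin \o (fun y => iter_Rintegral k (fun s => F (y :: s)))).
Proof.
move=> bk dF.
have iw := integrableZl measurableT (C * W ^+ k) integrable_oneDsqrV.
apply: (le_integrable measurableT _ _ iw).
  by apply/measurable_EFinP; exact: measurable_iter_Rintegral_cons dF.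
move=> y _; rewrite /= lee_fin (le_trans (bk _ _ (seq_dominated_cons y dF)))//.
by rewrite mulrAC ler_norm.
Qed.

Lemma iter_Rintegral_bound k C F :
  seq_dominated k C F -> `|iter_Rintegral k F| <= C * W ^+ k.
Proof.
elim: k C F => [|k IHk] C F dF /=.
  by have := dF.2 [::] erefl; rewrite big_nil.
have iF := integrable_iter_Rintegral_of_bound IHk dF.
rewrite (le_trans (le_normr_Rintegral _ iF))// exprSr mulrA.
rewrite -RintegralZl//; last exact: integrable_oneDsqrV.
apply: le_Rintegral => //.
- exact: (integrable_abse iF).
- exact: (integrableZl _ (C * W ^+ k) integrable_oneDsqrV).
- by move=> y _; rewrite mulrAC; exact/IHk/seq_dominated_cons.
Qed.

Lemma integrable_iter_Rintegral_cons k C F : seq_dominated k.+1 C F ->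
  mu.-integrable setT (EFin \o (fun y => iter_Rintegral k (fun s => F (y :: s)))).
Proof. by move=> dF; apply: integrable_iter_Rintegral_of_bound dF; exact: iter_Rintegral_bound. Qed.

(** Domination makes every inner integral finite, so the [fine] taken at each level loses
    nothing. *)
Lemma iter_integral_EFin k C F : seq_dominated k C F ->
  iter_integral k (fun s => (F s)%:E) = (iter_Rintegral k F)%:E.
Proof.
elim: k C F => [//|k IHk] C F dF /=.
rewrite /Rintegral fineK.
  by apply: eq_integral => y _; rewrite (IHk _ _ (seq_dominated_cons y dF)).
exact/integrable_fin_num/integrable_iter_Rintegral_cons/dF.
Qed.

Lemma iter_RintegralD k C D F G : seq_dominated k C F -> seq_dominated k D G ->
  iter_Rintegral k (fun s => F s + G s) = iter_Rintegral k F + iter_Rintegral k G.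
Proof.
elim: k C D F G => [//|k IHk] C D F G dF dG /=.
rewrite -RintegralD//; [|exact: integrable_iter_Rintegral_cons dF
                        |exact: integrable_iter_Rintegral_cons dG].
apply: eq_Rintegral => y _.
exact: (IHk _ _ _ _ (seq_dominated_cons y dF) (seq_dominated_cons y dG)).
Qed.

Lemma iter_RintegralZ k C F (r : R) : seq_dominated k C F ->
  iter_Rintegral k (fun s => r * F s) = r * iter_Rintegral k F.
Proof.
elim: k C F => [//|k IHk] C F dF /=.
rewrite -RintegralZl//; last exact: integrable_iter_Rintegral_cons dF.
apply: eq_Rintegral => y _; exact: (IHk _ _ (seq_dominated_cons y dF)).
Qed.

Lemma iter_Rintegral_ge0 k (F : seq R -> R) : (forall s, 0 <= F s) ->
  0 <= iter_Rintegral k F.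
Proof.
elim: k F => [|k IHk] F F0 //=; apply: fine_ge0; apply: integral_ge0 => y _.
by rewrite lee_fin; exact: IHk.
Qed.

End oneDsqrV.

(** * Integration over R^n and differentiation under the integral *)

Section vector_integral.
Context {R : realType} {n : nat}.
Implicit Types (f : 'rV[R]_n -> R) (x y : 'rV[R]_n).

Definition coord_measurable f : Prop :=
  forall d (T : measurableType d) (a : T -> 'rV[R]_n),
    (forall i, measurable_fun setT (fun s => a s ord0 i)) ->
    measurable_fun setT (fun s => f (a s)).

Lemma coord_measurable_continuous f : continuous f -> coord_measurable f.
Proof.
move=> cf d T a ma.
apply: (measurability _ (RGenOpens.measurableE R)).
move=> _ [_ [b1 [b2 ->]] <-]; rewrite setTI.
set U := (X in _ @^-1` X).
have oU : open U by exact: interval_open.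
(* An open set is a countable union of rational boxes, so its preimage is a
   countable union of preimages of boxes. *)
pose Q (q : 'rV[rat]_n * rat) := [set s : T |
  (forall y, (forall i, `|ratr (q.1 ord0 i) - y ord0 i| < ratr q.2) -> U (f y)) /\
  forall i, `|ratr (q.1 ord0 i) - a s ord0 i| < ratr q.2 ].
have -> : (fun s => f (a s)) @^-1` U = \bigcup_q Q q.
  apply/seteqP; split=> s /=; last by move=> [q _ [Uq sq]]; exact: Uq.
  move=> Us.
  have : nbhs (a s) (f @^-1` U) by apply: cf; exact: open_nbhs_nbhs.
  move=> /nbhs_ballP[e /= e0 eU].
  (* With [r] below [e / 2], the triangle inequality through the rational centre keeps the whole box
     inside the ball of radius [e]. *)
  have [r /= re] := rat_in_itvoo (divr_gt0 e0 (ltr0Sn R 1)).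
  have r0 : 0 < ratr r :> R by move: re; rewrite in_itv /= => /andP[].
  have [q qs] : exists q : 'rV[rat]_n,
      forall i, `|ratr (q ord0 i) - a s ord0 i| < ratr r :> R.
    have h i : exists q : rat, `|ratr q - a s ord0 i| < ratr r :> R.
      have /rat_in_itvoo[q] : a s ord0 i < a s ord0 i + ratr r by rewrite ltrDl.
      rewrite in_itv/= => /andP[h1 h2]; exists q.
      by rewrite gtr0_norm ?subr_gt0// ltrBlDl.
    have [q hq] := choice h.
    by exists (\row_i q i) => i; rewrite mxE.
  exists (q, r) => //=; split=> // y qy; apply: eU.
  split=> // i j; rewrite ord1 /ball /=.
  rewrite (le_lt_trans (ler_distD (ratr (q ord0 j)) _ _))//.
  rewrite [ltRHS]splitr.
  move: re; rewrite in_itv /= => /andP[_ re].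
  by apply: ltrD; [rewrite distrC|]; apply: lt_trans re.
apply: countable_bigcupT_measurable => [|q]; first exact: countableP.
(* The first clause of [Q q] does not involve [s], so [Q q] is either empty or the full preimage of
   the box. *)
have [hq|hq] := pselect (forall y : 'rV[R]_n,
    (forall i, `|ratr (q.1 ord0 i) - y ord0 i| < ratr q.2) -> U (f y)); last first.
  by rewrite (_ : Q q = set0)//; apply/seteqP; split=> s // [].
rewrite (_ : Q q = \bigcap_(i in [set: 'I_n])
  ((fun s => a s ord0 i) @^-1`
     [set z : R | `|ratr (q.1 ord0 i) - z| < ratr q.2])); last first.
  by apply/seteqP; split=> [s [_ h] i _|s h]; [exact: h|split=> // i; exact: h].
apply: fin_bigcap_measurable => // i _.
rewrite -[X in measurable X]setTI; apply: ma => //.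
exact: (@measurable_ball R (ratr (q.1 ord0 i)) (ratr q.2)).
Qed.

Definition admissible f : Prop := coord_measurable f /\
  exists C, forall y, `|f y| <= C * \prod_i (oneDsqr (y ord0 i))^-1.

Definition vint f : R := fine (integral_Rn f).

Lemma seq_dominated_admissible f : admissible f ->
  exists C, seq_dominated n C (fun s => f (row_of_seq n s)).
Proof.
move=> [mf [C fC]]; exists C; split.
  move=> d T p a mp ma.
  have := mf d T (fun s => row_of_seq n (mkseq (a^~ s) n)); apply => i.
  by under eq_fun do rewrite mxE nth_mkseq//; exact: ma.
move=> s sn; rewrite (le_trans (fC _))// (big_nth 0) sn big_mkord.
by under eq_bigr do rewrite mxE.
Qed.

Lemma vint_iter f : admissible f ->
  vint f = iter_Rintegral n (fun s => f (row_of_seq n s)).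
Proof.
move=> /seq_dominated_admissible[C df].
by rewrite /vint /integral_Rn (iter_integral_EFin df).
Qed.

Lemma admissibleD f h : admissible f -> admissible h ->
  admissible (fun y => f y + h y).
Proof.
move=> [mf [C fC]] [mh [D hD]]; split.
  by move=> d T a ma; apply: measurable_funD; [exact: mf|exact: mh].
exists (C + D) => y; rewrite mulrDl (le_trans (ler_normD _ _))//.
exact: lerD.
Qed.

Lemma admissibleZ (k : R) f : admissible f -> admissible (fun y => k * f y).
Proof.
move=> [mf [C fC]]; split.
  by move=> d T a ma; apply: measurable_funM => //; exact: mf.
by exists (`|k| * C) => y; rewrite normrM -mulrA ler_wpM2l.
Qed.

Lemma vintD f h : admissible f -> admissible h ->
  vint (fun y => f y + h y) = vint f + vint h.
Proof.
move=> af ah; rewrite !vint_iter//; last exact: admissibleD.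
have [C df] := seq_dominated_admissible af.
have [D dh] := seq_dominated_admissible ah.
exact: iter_RintegralD df dh.
Qed.

Lemma vintZ (k : R) f : admissible f -> vint (fun y => k * f y) = k * vint f.
Proof.
move=> af; rewrite !vint_iter//; last exact: admissibleZ.
have [C df] := seq_dominated_admissible af.
exact: iter_RintegralZ df.
Qed.

Lemma vint_ge0 f : admissible f -> (forall y, 0 <= f y) -> 0 <= vint f.
Proof.
by move=> af f0; rewrite vint_iter//; apply: iter_Rintegral_ge0 => s.
Qed.

Lemma vint_lin3 (a b c : R) f h k :
  admissible f -> admissible h -> admissible k ->
  admissible (fun y => a * f y + b * h y + c * k y) /\
  vint (fun y => a * f y + b * h y + c * k y) =
  a * vint f + b * vint h + c * vint k.
Proof.
move=> af ah ak.
have aaf := admissibleZ a af; have abh := admissibleZ b ah.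
have ack := admissibleZ c ak; have afh := admissibleD aaf abh.
split; first exact: admissibleD.
by rewrite (vintD afh ack) (vintD aaf abh) !vintZ.
Qed.

(** Positivity of the integral, applied to [h + f] and to [h - f]. *)
Lemma ler_norm_vint f h : admissible f -> admissible h ->
  (forall y, `|f y| <= h y) -> `|vint f| <= vint h.
Proof.
move=> af ah fh; rewrite ler_norml; apply/andP; split.
- have := vint_ge0 (admissibleD ah af); rewrite vintD// -lerBlDl sub0r.
  by apply=> y; rewrite -lerBlDl sub0r; have := fh y; rewrite ler_norml => /andP[].
- have aN := admissibleZ (-1) af.
  have := vint_ge0 (admissibleD ah aN); rewrite vintD// vintZ// mulN1r subr_ge0.
  by apply=> y; rewrite mulN1r subr_ge0 (le_trans _ (fh y))// ler_norm.
Qed.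

Lemma derive_quadratic_error {V : normedModType R} (f : V -> R) (x v : V) (L K : R) :
  (forall h, `|h| <= 1 -> `|f (h *: v + x) - f x - h * L| <= h ^+ 2 * K) ->
  'D_v f x = L.
Proof.
move=> fK; apply: cvg_lim => //; apply/cvgrPdist_le => e e0.
(* [|K| + 1] is a positive divisor whatever [K] is; the minimum with 1 below keeps [h] in the range
   where the error bound holds. *)
have K0 : 0 < `|K| + 1 by rewrite ltr_wpDl.
have m0 : 0 < Num.min 1 (e / (`|K| + 1)) by rewrite lt_min ltr01 divr_gt0.
near=> h.
have h0 : h != 0 by near: h; exact: nbhs_dnbhs_neq.
have : `|h| < Num.min 1 (e / (`|K| + 1)).
  by near: h; apply: dnbhs0_lt.
rewrite lt_min => /andP[/ltW h1]; rewrite ltr_pdivlMr// => /ltW he.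
rewrite /= -[L in `|L - _|](mulKf h0) -[_ *: _]/(_ * _) -mulrBr normrM normfV.
rewrite distrC ler_pdivrMl ?normr_gt0//.
rewrite (le_trans (fK _ h1))// -real_normK ?num_real// expr2 -mulrA.
rewrite ler_wpM2l// (le_trans _ he)// ler_wpM2l//.
by rewrite (le_trans (ler_norm _))// lerDl.
Unshelve. all: by end_near. Qed.

(** The factor [k] carries the normalisation of the heat kernel and, for second derivatives, also
    the constant produced by the first one. *)
Lemma derive_vint (phi : 'rV[R]_n -> 'rV[R]_n -> R) (psi D : 'rV[R]_n -> R)
    (k : R) (x v : 'rV[R]_n) :
  (forall z, admissible (phi z)) -> admissible psi -> admissible D ->
  (forall h y, `|h| <= 1 ->
    `|phi (h *: v + x) y - phi x y - h * psi y| <= h ^+ 2 * D y) ->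
  'D_v (fun z => k * vint (phi z)) x = k * vint psi.
Proof.
move=> aphi apsi aD hD.
apply: (@derive_quadratic_error _ _ _ _ _ (`|k| * vint D)) => h h1.
have [a3 e3] := vint_lin3 1 (-1) (- h) (aphi (h *: v + x)) (aphi x) apsi.
rewrite (_ : _ - _ - _ = k * (1 * vint (phi (h *: v + x)) + -1 * vint (phi x)
  + - h * vint psi)); last by ring.
rewrite -e3 normrM mulrCA ler_wpM2l// -vintZ//.
apply: ler_norm_vint => //; first exact: admissibleZ.
by move=> y; rewrite mul1r mulN1r mulNr hD.
Qed.

End vector_integral.

(** * Elementary bounds on the exponential *)

Section expR_bounds.
Context {R : realType}.
Implicit Types (s c h a v rho : R).

Lemma expR_sub1_le s : expR s - 1 <= s * expR s.
Proof.
have := expR_ge1Dx (- s); rewrite -(ler_pM2r (expR_gt0 s)) -expRD addNr expR0.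
by rewrite mulrDl mul1r mulNr; lra.
Qed.

Lemma normr_expR_sub1_le s : `|expR s - 1| <= `|s| * expR `|s|.
Proof.
have h1 := expR_ge1Dx s; have h2 := expR_sub1_le s.
have h3 := expR_ge1Dx `|s|; have s0 := normr_ge0 s.
have [s_ge0|s_lt0] := ger0P s.
  by rewrite ger0_norm//; lra.
rewrite ler0_norm; last by rewrite subr_le0 -expR0 ler_expR ltW.
rewrite (ltr0_norm s_lt0) in h3 *; nra.
Qed.

(** The error is nonnegative and, by [expR_sub1_le], at most [s * (expR s - 1)]; one more
    first-order bound gives the square. *)
Lemma normr_expR_taylor1_le s : `|expR s - 1 - s| <= s ^+ 2 * expR `|s|.
Proof.
have h1 := expR_ge1Dx s; have h2 := expR_sub1_le s.
rewrite ger0_norm; last lra.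
have [s_ge0|s_lt0] := ger0P s; first nra.
have h3 := expR_ge1Dx (- s); nra.
Qed.

(** [(c * v) ^+ m / m!] is a single term of the series of [expR (c * v)], hence the constant
    [m! / c ^+ m]. *)
Lemma expR_monomial_bound c m : 0 < c ->
  exists2 K, 0 <= K & forall v, 0 <= v -> v ^+ m * expR (- (c * v)) <= K.
Proof.
move=> c0; exists (m`!%:R / c ^+ m) => [|v v0].
  by rewrite divr_ge0// exprn_ge0// ltW.
have cv0 : 0 <= c * v by rewrite mulr_ge0// ltW.
rewrite expRN ler_pdivlMr ?exprn_gt0// mulrAC ler_pdivrMr ?expR_gt0//.
rewrite -exprMn mulrC -ler_pdivrMl ?ltr0n ?fact_gt0//.
case: m => [|m]; first by rewrite expr0 fact0 invr1 mulr1 -expR0 ler_expR.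
by have := expR_ge1Dxn m cv0; rewrite mulrC [v * c]mulrC; lra.
Qed.

(** Here [rho] stands for 1 + |x-y|^2, [a] for x_j - y_j, and [s] for the change of the Gaussian
    exponent when x moves by [h] along the j-th axis. Half of the decay rate [c] is spent on
    absorbing [expR |s|]. *)
Lemma gauss_shift_bound c h a rho :
  0 < c -> `|h| <= 1 -> 1 + a ^+ 2 <= rho ->
  let s := - (c * (2 * h * a + h ^+ 2)) in
  let E := expR (7 / 2 * c) * expR (- (c / 2 * rho)) in
  `|expR s - 1| * expR (- (c * (rho - 1))) <= `|h| * (2 * c * rho * E) /\
  `|expR s - 1 + 2 * c * h * a| * expR (- (c * (rho - 1)))
    <= h ^+ 2 * ((4 * c ^+ 2 + c) * rho ^+ 2 * E).
Proof.
move=> c0 h1 ar s E.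
have a0 := normr_ge0 a; have h0 := normr_ge0 h.
have aa : `|a| ^+ 2 = a ^+ 2 by rewrite real_normK ?num_real.
have r1 : 1 <= rho by nra.
have sE : `|s| = c * (`|h| * `|2 * a + h|).
  by rewrite normrN normrM (gtr0_norm c0) -normrM; congr (_ * `|_|); ring.
have ah : `|2 * a + h| <= 2 * `|a| + 1.
  by rewrite (le_trans (ler_normD _ _))// normrM ger0_norm//; lra.
have n0 := normr_ge0 (2 * a + h).
have s1 : `|s| <= `|h| * (2 * c * rho).
  rewrite sE mulrCA ler_wpM2l// -mulrA mulrCA ler_wpM2l//; first exact: ltW.
  nra.
(* From (|a| - 2)^2 >= 0 one gets 2|a| + 1 <= rho/2 + 5/2; subtracting c(rho - 1) then leaves 7c/2 -
   c rho/2, the exponent of [E]. *)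
have s2 : `|s| <= c * (rho / 2 + 5 / 2).
  rewrite sE ler_wpM2l ?(ltW c0)// (le_trans (ler_piMl n0 h1))// (le_trans ah)//.
  have := sqr_ge0 (`|a| - 2); rewrite -aa in ar; nra.
have eE : expR `|s| * expR (- (c * (rho - 1))) <= E.
  by rewrite /E -!expRD ler_expR; nra.
have eE' : expR (- (c * (rho - 1))) <= E.
  by rewrite (le_trans _ eE)// ler_peMl ?expR_ge0// -expR0 ler_expR.
have E0 : 0 <= E by rewrite (le_trans (expR_ge0 _) eE').
split.
  rewrite (le_trans (ler_wpM2r (expR_ge0 _) (normr_expR_sub1_le s)))//.
  rewrite -[leLHS]mulrA [leRHS]mulrA.
  by apply: ler_pM => //; rewrite mulr_ge0 ?expR_ge0.
(* The part of [s] linear in [h] is -2cha, so what remains beyond the Taylor error of the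
   exponential is c h^2. *)
rewrite (_ : _ + _ = (expR s - 1 - s) - c * h ^+ 2); last by rewrite /s; ring.
have B1 : `|expR s - 1 - s| * expR (- (c * (rho - 1))) <=
    h ^+ 2 * (4 * c ^+ 2 * rho ^+ 2 * E).
  rewrite (le_trans (ler_wpM2r (expR_ge0 _) (normr_expR_taylor1_le s)))//.
  rewrite -[leLHS]mulrA [leRHS]mulrA.
  apply: ler_pM => //; rewrite ?sqr_ge0 ?mulr_ge0 ?expR_ge0//.
  rewrite -[s ^+ 2]real_normK ?num_real// -[h ^+ 2]real_normK ?num_real//.
  rewrite (_ : _ * (_ * _) = (`|h| * (2 * c * rho)) ^+ 2); last by ring.
  by rewrite lerXn2r// nnegrE// !mulr_ge0 ?(ltW c0)//; lra.
have B2 : `|c * h ^+ 2| * expR (- (c * (rho - 1))) <= h ^+ 2 * (c * rho ^+ 2 * E).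
  have ch0 : 0 <= c * h ^+ 2 by rewrite mulr_ge0 ?sqr_ge0 ?(ltW c0).
  have rE : E <= rho ^+ 2 * E.
    rewrite ler_peMl// -[1](expr1n _ 2).
    by rewrite lerXn2r// nnegrE; lra.
  have := ler_wpM2l ch0 (le_trans eE' rE).
  by rewrite (ger0_norm ch0); lra.
rewrite (le_trans (ler_wpM2r (expR_ge0 _) (ler_normB _ _)))// mulrDl.
by rewrite (le_trans (lerD B1 B2))//; lra.
Qed.

End expR_bounds.

(** * Squared distances and integrability under Gaussian bounds *)

Section heat_moments.
Context {R : realType} {n : nat}.
Implicit Types x y z : 'rV[R]_n.

Lemma sqdist_ge0 x y : 0 <= sqdist x y.
Proof. by apply: sumr_ge0 => i _; exact: sqr_ge0. Qed.

Lemma sqdist_ge_coord x y i : (x ord0 i - y ord0 i) ^+ 2 <= sqdist x y.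
Proof.
rewrite /sqdist (bigD1 i)//= lerDl.
by apply: sumr_ge0 => j _; exact: sqr_ge0.
Qed.

Lemma coord_unitv_shift x (h : R) i j :
  (h *: unitv R j + x) ord0 i = x ord0 i + h * (i == j)%:R.
Proof. by rewrite !mxE eqxx /= addrC eq_sym. Qed.

Lemma sqdist_unitv_shift x y (h : R) j :
  sqdist (h *: unitv R j + x) y =
  sqdist x y + (2 * h * (x ord0 j - y ord0 j) + h ^+ 2).
Proof.
rewrite /sqdist (bigD1 j)//= [in RHS](bigD1 j)//= coord_unitv_shift eqxx mulr1.
rewrite (eq_bigr (fun i => (x ord0 i - y ord0 i) ^+ 2)); first by ring.
by move=> i /negPf ij; rewrite coord_unitv_shift ij mulr0 addr0.
Qed.

Lemma coord_le_sqdist x y i : `|x ord0 i - y ord0 i| <= 1 + sqdist x y.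
Proof.
have := sqdist_ge_coord x y i; rewrite -real_normK ?num_real//.
have := sqr_ge0 (`|x ord0 i - y ord0 i| - 1); nra.
Qed.

(* [1 + y_i^2 <= 2 (1 + x_i^2) (1 + (x_i - y_i)^2)] in each coordinate. *)
Lemma prod_oneDsqrV_ge x : exists2 A, 0 < A & forall y,
  ((A * (1 + sqdist x y)) ^+ n)^-1 <= \prod_i (oneDsqr (y ord0 i))^-1.
Proof.
have S0 := sqdist_ge0 x 0.
exists (2 * (1 + sqdist x 0)) => [|y]; first lra.
rewrite prodfV lef_pV2 ?posrE; last 2 first.
- by rewrite exprn_gt0// mulr_gt0//; have := sqdist_ge0 x y; lra.
- by apply: prodr_gt0 => i _; rewrite /oneDsqr; have := sqr_ge0 (y ord0 i); lra.
rewrite -[X in _ ^+ X]card_ord -prodr_const.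
apply: ler_prod => i _; rewrite /oneDsqr.
have hx : x ord0 i ^+ 2 <= sqdist x 0.
  by have := sqdist_ge_coord x 0 i; rewrite mxE subr0.
have hy := sqdist_ge_coord x y i.
have y0 := sqr_ge0 (y ord0 i); have x0 := sqr_ge0 (x ord0 i).
have z0 := sqr_ge0 (x ord0 i - y ord0 i).
(* (2x_i - y_i)^2 >= 0 rearranges to y_i^2 <= 2 x_i^2 + 2 (x_i - y_i)^2. *)
have w0 := sqr_ge0 (2 * x ord0 i - y ord0 i).
apply/andP; split; nra.
Qed.

Lemma coord_measurable_sqdist x : coord_measurable (sqdist x).
Proof.
move=> d T a ma; apply: measurable_sum => i.
by apply: measurable_funX; apply: measurable_funB.
Qed.

(** The monomial bound is used at degree [m + n]: the [n] extra powers of 1 + |x-y|^2 pay for the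
    product of the [n] one-dimensional weights. *)
Lemma admissible_gauss_bound (f : 'rV[R]_n -> R) x (C c : R) m :
  coord_measurable f -> 0 < c ->
  (forall y, `|f y| <= C * ((1 + sqdist x y) ^+ m * expR (- (c * (1 + sqdist x y))))) ->
  admissible f.
Proof.
move=> mf c0 fC; split=> //.
have [A A0 hA] := prod_oneDsqrV_ge x.
have [K K0 hK] := expR_monomial_bound (m + n) c0.
exists (`|C| * K * A ^+ n) => y.
have r0 : 0 < 1 + sqdist x y by have := sqdist_ge0 x y; lra.
rewrite (le_trans (fC y))//.
apply: (@le_trans _ _ (`|C| * K * A ^+ n * ((A * (1 + sqdist x y)) ^+ n)^-1)); last first.
  by rewrite ler_wpM2l// !mulr_ge0// exprn_ge0// ltW.
rewrite exprMn invfM -mulrA mulVKf ?expf_neq0 ?gt_eqF//.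
have e0 : 0 <= (1 + sqdist x y) ^+ m * expR (- (c * (1 + sqdist x y))).
  by rewrite mulr_ge0 ?expR_ge0// exprn_ge0// ltW.
rewrite (le_trans (ler_wpM2r e0 (ler_norm C)))// -mulrA ler_wpM2l//.
rewrite ler_pdivlMr ?exprn_gt0// (le_trans _ (hK _ (ltW r0)))//.
by rewrite exprD mulrAC.
Qed.


Definition heat_ker (g : 'rV[R]_n -> R) (t : R) x y : R :=
  g y * expR (- (sqdist x y / (4 * t))).

(** * Moments of the heat kernel for a fixed datum and their derivatives *)

Section fixed_datum.
Variables (g : 'rV[R]_n -> R) (M t : R).
Hypothesis g_cont : continuous g.
Hypothesis g_bound : forall y, `|g y| <= M.
Hypothesis t_gt0 : 0 < t.
Let c : R := (4 * t)^-1.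
Let c_gt0 : 0 < c. Proof. by rewrite invr_gt0 mulr_gt0. Qed.
Let M_ge0 : 0 <= M. Proof. exact: le_trans (g_bound 0). Qed.
(** The offset 1 makes powers of [rho] increase with the exponent and lets [rho] dominate each
    coordinate difference. *)
Let rho x y : R := 1 + sqdist x y.
Let dx (i : 'I_n) x y : R := x ord0 i - y ord0 i.

Let rho_ge1 x y : 1 <= rho x y.
Proof. by rewrite lerDl sqdist_ge0. Qed.

Let dx_rho i x y : 1 + dx i x y ^+ 2 <= rho x y.
Proof. by rewrite lerD2l sqdist_ge_coord. Qed.

Let heat_kerE x y : heat_ker g t x y = g y * expR (- (c * (rho x y - 1))).
Proof. by rewrite /heat_ker /rho addrAC subrr add0r mulrC [c * _]mulrC mulrC. Qed.

Let heat_ker_shift x y h j :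
  heat_ker g t (h *: unitv R j + x) y =
  heat_ker g t x y * expR (- (c * (2 * h * dx j x y + h ^+ 2))).
Proof.
rewrite !heat_kerE -mulrA -expRD /rho sqdist_unitv_shift; congr (_ * expR _).
by rewrite /dx; ring.
Qed.

Let coord_measurable_heat_ker x : coord_measurable (heat_ker g t x).
Proof.
move=> d T a ma; apply: measurable_funM.
  exact: (coord_measurable_continuous g_cont ma).
apply: measurableT_comp => //; apply: measurableT_comp => //.
by apply: measurable_funM => //; exact: coord_measurable_sqdist ma.
Qed.

Let coord_measurable_dx i x : coord_measurable (dx i x).
Proof. by move=> d T a ma; apply: measurable_funB. Qed.

Lemma admissible_heat_ker x (P : 'rV[R]_n -> R) m :
  coord_measurable P -> (forall y, `|P y| <= rho x y ^+ m) ->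
  admissible (fun y => P y * heat_ker g t x y).
Proof.
move=> mP hP; apply: (@admissible_gauss_bound _ x (M * expR c) c m) => //.
  move=> d T a ma; apply: measurable_funM; first exact: mP.
  exact: coord_measurable_heat_ker ma.
move=> y; rewrite heat_kerE !normrM (ger0_norm (expR_ge0 _)).
rewrite (_ : - (c * (rho x y - 1)) = c + - (c * (1 + sqdist x y))); last first.
  by rewrite /rho; ring.
rewrite expRD mulrCA -[leRHS]mulrA; apply: ler_pM => //.
by rewrite mulrCA ler_wpM2l ?expR_ge0// ler_wpM2r ?expR_ge0.
Qed.

Lemma admissible_heat x : admissible (heat_ker g t x).
Proof.
rewrite (_ : heat_ker g t x = (fun y => 1 * heat_ker g t x y)).
  apply: (@admissible_heat_ker _ (fun=> 1) 0%N) => // y.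
  by rewrite normr1.
by apply/funext => y; rewrite mul1r.
Qed.

Lemma admissible_heat_dx i x : admissible (fun y => dx i x y * heat_ker g t x y).
Proof.
by apply: (@admissible_heat_ker _ _ 1%N) => // y; rewrite coord_le_sqdist.
Qed.

Lemma admissible_heat_dx2 i j x :
  admissible (fun y => dx i x y * dx j x y * heat_ker g t x y).
Proof.
apply: (@admissible_heat_ker _ (fun y => dx i x y * dx j x y) 2%N) => [d T a ma|y].
  by apply: measurable_funM; exact: coord_measurable_dx ma.
by rewrite normrM expr2 ler_pM// coord_le_sqdist.
Qed.

(** Supplies the integrable majorants of the Taylor remainders; the rate [c / 2] is what
    [gauss_shift_bound] leaves. *)
Let heat_remainder_bound x (C : R) m :
  admissible (fun y => C * (rho x y ^+ m *
    (expR (7 / 2 * c) * expR (- (c / 2 * rho x y))))).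
Proof.
apply: (@admissible_gauss_bound _ x (`|C| * expR (7 / 2 * c)) (c / 2) m).
- move=> d T a ma; apply: measurable_funM => //.
  have mr : measurable_fun setT (fun s => rho x (a s)).
    by apply: measurable_funD => //; exact: coord_measurable_sqdist ma.
  apply: measurable_funM; first exact: measurable_funX.
  apply: measurable_funM => //; apply: measurableT_comp => //.
  by apply: measurableT_comp => //; exact: measurable_funM.
- by rewrite divr_gt0.
- move=> y; rewrite normrM [X in _ * X]ger0_norm; last first.
    by rewrite !mulr_ge0 ?expR_ge0// exprn_ge0// (le_trans ler01).
  by rewrite -[leRHS]mulrA ler_wpM2l// mulrCA.
Qed.

Lemma derive_vint_heat k x j :
  'D_(unitv R j) (fun z => k * vint (heat_ker g t z)) x =
  k * (- (2 * c) * vint (fun y => dx j x y * heat_ker g t x y)).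
Proof.
rewrite -vintZ; last exact: admissible_heat_dx.
apply: (derive_vint _ _ _ (heat_remainder_bound x (M * (4 * c ^+ 2 + c)) 2)) => //.
- exact: admissible_heat.
- exact/admissibleZ/admissible_heat_dx.
move=> h y h1; rewrite heat_ker_shift.
have [_ hb] := gauss_shift_bound c_gt0 h1 (dx_rho j x y).
set s := - (c * _) in hb *.
rewrite (_ : _ - _ - _ =
  heat_ker g t x y * (expR s - 1 + 2 * c * h * dx j x y)); last by ring.
rewrite heat_kerE !normrM (ger0_norm (expR_ge0 _)) -mulrA.
rewrite [leRHS](_ : _ = M * (h ^+ 2 * ((4 * c ^+ 2 + c) * rho x y ^+ 2 *
  (expR (7 / 2 * c) * expR (- (c / 2 * rho x y)))))); last by ring.
by rewrite ler_pM// mulrC.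
Qed.

Lemma derive_vint_heat_dx k x i j :
  'D_(unitv R j) (fun z => k * vint (fun y => dx i z y * heat_ker g t z y)) x =
  k * ((i == j)%:R * vint (heat_ker g t x)
    - 2 * c * vint (fun y => dx i x y * dx j x y * heat_ker g t x y)).
Proof.
rewrite (_ : _ - _ = vint (fun y => (i == j)%:R * heat_ker g t x y +
  - (2 * c) * (dx i x y * dx j x y * heat_ker g t x y))); last first.
  rewrite vintD; [|exact/admissibleZ/admissible_heat|exact/admissibleZ/admissible_heat_dx2].
  by rewrite !vintZ ?mulNr//; [exact: admissible_heat_dx2|exact: admissible_heat].
(* The factor [dx i] raises the power of [rho] to 3 and keeps 4c^2 + c; the cross term adds 2c,
   using rho <= rho^3. *)
apply: (derive_vint _ _ _ (heat_remainder_bound x (M * (4 * c ^+ 2 + 3 * c)) 3)) => //.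
- by move=> z; exact: admissible_heat_dx.
- by apply: admissibleD; apply: admissibleZ;
    [exact: admissible_heat|exact: admissible_heat_dx2].
move=> h y h1; rewrite heat_ker_shift.
have [ha hb] := gauss_shift_bound c_gt0 h1 (dx_rho j x y).
set s := - (c * _) in ha hb *.
set b : R := (i == j)%:R.
have dxE : dx i (h *: unitv R j + x) y = dx i x y + h * b.
  by rewrite /dx coord_unitv_shift addrAC.
(* Product rule with remainder: the second-order error of the Gaussian times [dx i], plus the shift
   [h * b] times its first-order error, each of order h^2. *)
rewrite dxE (_ : _ - _ - _ = heat_ker g t x y *
  (dx i x y * (expR s - 1 + 2 * c * h * dx j x y) + h * b * (expR s - 1))); last by ring.
have b1 : `|b| <= 1 by rewrite /b; case: eqP => _; rewrite ?normr1 ?normr0.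
set E := expR (7 / 2 * c) * _ in ha hb *.
set e := expR (- (c * (rho x y - 1))) in ha hb *.
have e0 : 0 <= e by exact: expR_ge0.
have E0 : 0 <= E by rewrite mulr_ge0 ?expR_ge0.
rewrite heat_kerE -/e !normrM (ger0_norm e0) -mulrA.
rewrite [leRHS](_ : _ = M * (h ^+ 2 * ((4 * c ^+ 2 + 3 * c) *
  rho x y ^+ 3 * E))); last by ring.
rewrite ler_pM ?mulr_ge0//.
rewrite (le_trans (ler_wpM2l e0 (ler_normD _ _)))// !normrM mulrDr.
have r1 := rho_ge1 x y; have r0 : 0 <= rho x y by lra.
have B1 := ler_pM (normr_ge0 _) (mulr_ge0 (normr_ge0 _) e0) (coord_le_sqdist x y i) hb.
have B2 : `|h| * `|b| * (`|expR s - 1| * e) <= `|h| * (`|h| * (2 * c * rho x y * E)).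
  by apply: ler_pM => //; [rewrite mulr_ge0|rewrite ler_piMr].
have rr : 2 * c * rho x y * E <= 2 * c * rho x y ^+ 3 * E.
  rewrite ler_wpM2r// ler_wpM2l ?mulr_ge0 ?(ltW c_gt0)//.
  by rewrite exprS ler_peMr// exprn_ege1.
have hh : `|h| * `|h| = h ^+ 2 by rewrite -expr2 real_normK ?num_real.
have := ler_wpM2l (sqr_ge0 h) rr.
move: B1 B2; rewrite -/(rho x y) -/(dx i x y) [`|h| * (`|h| * _)]mulrA hh.
lra.
Qed.

End fixed_datum.
End heat_moments.

(** * The algebraic inequality between moments *)

Lemma sum_offdiag_le {R : realFieldType} (n : nat) (A : 'I_n -> 'I_n -> R) :
  (forall i j, 2 * A i j <= A i i + A j j) ->
  \sum_(i < n) \sum_(j < n | j != i) A i j <= (n%:R - 1) * \sum_(i < n) A i i.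
Proof.
move=> hA; set T := \sum_(i < n) A i i.
have sumc (k : R) : \sum_(i < n) k = k * n%:R.
  by rewrite sumr_const card_ord mulr_natr.
(* Row [i] of (A_ii + A_jj)/2 sums to (n A_ii + T)/2 over all j; removing the diagonal entry
   subtracts A_ii. *)
apply: (@le_trans _ _ (\sum_(i < n) ((n%:R / 2 - 1) * A i i + T / 2))).
  apply: ler_sum => i _.
  rewrite (_ : _ + _ = \sum_(j < n | j != i) (A i i + A j j) / 2).
    by apply: ler_sum => j _; have := hA i j; lra.
  have : \sum_(j < n) (A i i + A j j) / 2 = (A i i * n%:R + T) / 2.
    by rewrite -mulr_suml big_split /= sumc.
  by rewrite (bigD1 i)//=; lra.
rewrite big_split /= -mulr_sumr sumc -/T; lra.
Qed.

(** All three subtracted terms are bounded by multiples of the trace T of [S], with total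
    coefficient (n-1)(a+b) + g <= 1; the [b] and [g] terms pass through sum m_i^2 <= T. *)
Lemma heat_quadratic_ge0 {R : realFieldType} (n : nat)
    (S : 'I_n -> 'I_n -> R) (m : 'I_n -> R) (a b g : R) :
  (0 < n)%N -> 0 <= a -> 0 <= b -> 0 <= g -> (n%:R - 1) * (a + b) + g <= 1 ->
  (forall i j, 2 * S i j <= S i i + S j j) -> (forall i, m i ^+ 2 <= S i i) ->
  0 <= \sum_(i < n) S i i - a * (\sum_(i < n) \sum_(j < n | j != i) S i j)
    - b * (\sum_(i < n) \sum_(j < n | j != i) m i * m j)
    - g * (\sum_(i < n) m i ^+ 2).
Proof.
move=> n0 a0 b0 g0 habg hS hm.
have n1 : 0 <= n%:R - 1 :> R by rewrite subr_ge0 ler1n.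
have h1 := sum_offdiag_le hS.
have h2 : \sum_(i < n) \sum_(j < n | j != i) m i * m j
    <= (n%:R - 1) * \sum_(i < n) m i ^+ 2.
  apply: (@sum_offdiag_le _ _ (fun i j => m i * m j)) => i j.
  by have := sqr_ge0 (m i - m j); lra.
have h3 : \sum_(i < n) m i ^+ 2 <= \sum_(i < n) S i i by exact: ler_sum.
have P0 : 0 <= \sum_(i < n) m i ^+ 2 by apply: sumr_ge0 => i _; exact: sqr_ge0.
set T := \sum_(i < n) S i i in h1 h3 *; set P := \sum_(i < n) m i ^+ 2 in h2 h3 P0 *.
have k1 := ler_wpM2l a0 h1; have k2 := ler_wpM2l b0 h2.
have k3 := ler_wpM2l (mulr_ge0 b0 n1) h3; have k4 := ler_wpM2l g0 h3.
have k5 := ler_wpM2r (le_trans P0 h3) habg.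
lra.
Qed.

(** * The differential inequality from the moment inequality *)

Theorem theorem2p1 (R : realType) (n : nat) (g : 'rV[R]_n -> R)
    (alpha beta gamma : R) :
  (0 < n)%N ->
  continuous g ->
  (exists M : R, forall y, `|g y| <= M) ->
  (forall y, 0 <= g y) ->
  (exists y, g y != 0) ->
  0 <= alpha -> 0 <= beta -> 0 <= gamma ->
  (n%:R - 1) * (alpha + beta) + gamma <= 1 ->
  let u := heat_sol g in
  forall (x : 'rV[R]_n) (t : R), 0 < t ->
    (\sum_(i < n) pd2 u i i x t) / u x t
    - alpha * (\sum_(i < n) \sum_(j < n | j != i) pd2 u i j x t / u x t)
    - beta * (\sum_(i < n) \sum_(j < n | j != i)
                pd1 u i x t * pd1 u j x t / (u x t ^+ 2))
    - gamma * ((\sum_(i < n) pd1 u i x t ^+ 2) / (u x t ^+ 2))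
    >= - (n%:R / (2 * t)).
Proof.
move=> n0 cg [M gM] g0 _ a0 b0 c0 habc u x t t0.
pose k := ((4 * pi * t) `^ (n%:R / 2))^-1.
have k0 : 0 < k by rewrite invr_gt0 powR_gt0// !mulr_gt0// pi_gt0.
pose c := (4 * t)^-1.
pose dx i (z y : 'rV[R]_n) := z ord0 i - y ord0 i.
pose U := vint (heat_ker g t x).
pose Mi i := vint (fun y => dx i x y * heat_ker g t x y).
pose S i j := vint (fun y => dx i x y * dx j x y * heat_ker g t x y).
have ker_ge0 y : 0 <= heat_ker g t x y by rewrite mulr_ge0 ?expR_ge0.
have aU : admissible (heat_ker g t x) := admissible_heat cg gM t0 x.
have aM i : admissible (fun y => dx i x y * heat_ker g t x y) :=
  admissible_heat_dx cg gM t0 i x.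
have aS i j : admissible (fun y => dx i x y * dx j x y * heat_ker g t x y) :=
  admissible_heat_dx2 cg gM t0 i j x.
have uE : u x t = k * U by [].
have p1E z i : 'D_(unitv R i) (fun z => u z t) z =
    k * (- (2 * c)) * vint (fun y => dx i z y * heat_ker g t z y).
  by rewrite (derive_vint_heat cg gM t0 k z i) mulrA.
have p1x i : pd1 u i x t = k * (- (2 * c)) * Mi i by exact: p1E.
have p2x i j : pd2 u i j x t =
    k * (- (2 * c)) * ((i == j)%:R * U - 2 * c * S i j).
  rewrite /pd2 (funext (fun z => p1E z i)).
  exact: (derive_vint_heat_dx cg gM t0).
have U_ge0 : 0 <= U by exact: vint_ge0.
have [U0|U0] := eqVneq U 0.
  (* Every quotient has denominator [0], hence is [0]. *)
  rewrite uE U0 mulr0 expr0n /= invr0 !mulr0.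
  rewrite [X in alpha * X]big1; last first.
    by move=> i _; rewrite big1// => j _; rewrite mulr0.
  rewrite [X in beta * X]big1; last first.
    by move=> i _; rewrite big1// => j _; rewrite mulr0.
  by rewrite !mulr0 !subr0 oppr_le0 divr_ge0// mulr_ge0// ltW.
have U_gt0 : 0 < U by rewrite lt_neqAle eq_sym U0.
pose s i j := S i j / U; pose m i := Mi i / U.
(* Integrate (dx_i - dx_j)^2 >= 0 against the kernel. *)
have hS i j : 2 * s i j <= s i i + s j j.
  have [al vl] := vint_lin3 1 1 (-2) (aS i i) (aS j j) (aS i j).
  have := vint_ge0 al; rewrite vl -/(S i i) -/(S j j) -/(S i j) => h.
  rewrite /s mulrA -mulrDl ler_pM2r ?invr_gt0// -subr_ge0.
  rewrite (_ : _ - _ = 1 * S i i + 1 * S j j + -2 * S i j); last by ring.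
  apply: h => y.
  rewrite (_ : _ + _ = (dx i x y - dx j x y) ^+ 2 * heat_ker g t x y); last by ring.
  by rewrite mulr_ge0// sqr_ge0.
(* Nonnegativity of the variance: integrate (dx_i - m_i)^2 against the kernel. *)
have hm i : m i ^+ 2 <= s i i.
  have [al vl] := vint_lin3 1 (- (2 * m i)) (m i ^+ 2) (aS i i) (aM i) aU.
  have := vint_ge0 al; rewrite vl -/(S i i) -/(Mi i) -/U => h.
  rewrite /s ler_pdivlMr// -subr_ge0.
  rewrite (_ : _ - _ = 1 * S i i + - (2 * m i) * Mi i + m i ^+ 2 * U); last first.
    by rewrite /m; field.
  apply: h => y.
  rewrite (_ : _ + _ = (dx i x y - m i) ^+ 2 * heat_ker g t x y); last by ring.
  by rewrite mulr_ge0// sqr_ge0.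
have kU : k * U != 0 by rewrite mulf_neq0// gt_eqF.
have p2u i j : pd2 u i j x t / u x t = - (2 * c) * (i == j)%:R + (2 * c) ^+ 2 * s i j.
  by rewrite p2x uE /s; field; rewrite U0 gt_eqF.
have p1u i j : pd1 u i x t * pd1 u j x t / u x t ^+ 2 = (2 * c) ^+ 2 * (m i * m j).
  by rewrite !p1x uE /m; field; rewrite U0 gt_eqF.
(* Each diagonal entry contributes -2c = -1/(2t); the [n] of them produce exactly the right-hand
   side of the claim. *)
have -> : (\sum_(i < n) pd2 u i i x t) / u x t =
    - (n%:R / (2 * t)) + (2 * c) ^+ 2 * \sum_(i < n) s i i.
  rewrite mulr_suml (eq_bigr _ (fun i _ => p2u i i)) big_split /= -!mulr_sumr.
  rewrite [X in - (2 * c) * X](eq_bigr (fun=> 1)); last by move=> i _; rewrite eqxx.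
  rewrite sumr_const card_ord; congr (_ + _).
  by rewrite /c; field; rewrite gt_eqF.
have -> : \sum_(i < n) \sum_(j < n | j != i) pd2 u i j x t / u x t =
    (2 * c) ^+ 2 * \sum_(i < n) \sum_(j < n | j != i) s i j.
  rewrite mulr_sumr; apply: eq_bigr => i _; rewrite mulr_sumr.
  by apply: eq_bigr => j /negPf ji; rewrite p2u eq_sym ji mulr0 add0r.
have -> : \sum_(i < n) \sum_(j < n | j != i)
      pd1 u i x t * pd1 u j x t / u x t ^+ 2 =
    (2 * c) ^+ 2 * \sum_(i < n) \sum_(j < n | j != i) m i * m j.
  rewrite mulr_sumr; apply: eq_bigr => i _; rewrite mulr_sumr.
  by apply: eq_bigr => j _; exact: p1u.
have -> : (\sum_(i < n) pd1 u i x t ^+ 2) / u x t ^+ 2 =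
    (2 * c) ^+ 2 * \sum_(i < n) m i ^+ 2.
  rewrite mulr_suml mulr_sumr; apply: eq_bigr => i _; exact: p1u.
have := mulr_ge0 (sqr_ge0 (2 * c)) (heat_quadratic_ge0 n0 a0 b0 c0 habc hS hm).
lra.
Qed.
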